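(* Let $M,N,m,k\in\mathbb{N}\cup\{0\}$ with $m\ge k$. Let $(\mathcal U,\mathcal V)$ be a $(M,N)$-$D_\nu$-coherent pair of order $(m,k)$ of regular linear functionals, i.e. their respective sequences of monic orthogonal polynomials $\{P_n(x)\}_{n\ge0}$ and $\{Q_n(x)\}_{n\ge0}$ satisfy $$P^{[m,\nu]}_{n}(x)+\sum_{i=1}^M a_{i,n}P^{[m,\nu]}_{n-i}(x)=Q^{[k,\nu]}_{n}(x)+\sum_{i=1}^N b_{i,n}Q^{[k,\nu]}_{n-i}(x),\qquad n\ge 0,$$ where $a_{i,n},b_{i,n}\in\mathbb{C}$, $a_{M,n}\ne0$ for $n\ge M$, $b_{N,n}\neq0$ for $n\geq N$, and $a_{i,n}=b_{i,n}=0$ if $i>n$. Let $\mathcal{L}_{M+N}=[l_{i,j}]_{i,j=0}^{M+N-1}$ be the square matrix of order $M+N$ with $$l_{i,j}=\begin{cases} a_{j-i,j} & \text{if } 0\le i\le N-1 \text{ and } i\le j\le M+i,\\ b_{j-i+N,j} & \text{if } N\le i\le M+N-1 \text{ and } i-N\le j\le i,\\ 0 & \text{otherwise,}\end{cases}$$ where $a_{0,j_1}=b_{0,j_2}=1$ for $0\le j_1\le N-1$, $0\le j_2\le M-1$. If $\det(\mathcal{L}_{M+N})\ne0$, then for every $n\ge0$ there exist polynomials $\phi_{M+k+n}(x;\nu)$ and $\psi_{N+m+n}(x;\nu)$, of degrees $M+k+n$ and $N+m+n$ respectively, such that $$D_{\nu^*}^{m-k}\big[\phi_{M+k+n}(x;\nu)\,\mathcal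 V\big]=\psi_{N+m+n}(x;\nu)\,\mathcal U,\qquad n\ge0,$$ and there exist nonzero polynomials $\varphi(x;\nu)$ and $\rho(x;\nu)$ such that $$\varphi(x;\nu)\,\mathcal U=\rho(x;\nu)\,\mathcal V.$$ Furthermore: 1. If $k=m$, then $\mathcal U$ is a $D_\nu$-semiclassical linear functional if and only if so is $\mathcal V$. 2. If $m>k$, then $\mathcal U$ and $\mathcal V$ are both $D_\nu$-semiclassical linear functionals.
   Context: $\mathbb{P}$ is the space of polynomials with complex coefficients and $\mathbb{P}'$ its (algebraic) dual; $\langle \mathcal U,p(x)\rangle$ is the image of $p$ under $\mathcal U\in\mathbb{P}'$. For $\pi\in\mathbb{P}$, $\pi(x)\mathcal U\in\mathbb{P}'$ is defined by $\langle\pi\,\mathcal U,p\rangle=\langle\mathcal U,\pi p\rangle$. Throughout, $\nu$ is either $\omega\in\mathbb{C}\setminus\{0\}$, with $D_\omega p(x)=\frac{p(x+\omega)-p(x)}{\omega}$, or $q\in\mathbb{C}\setminus\{0,\pm1\}$, with $D_q p(x)=\frac{p(qx)-p(x)}{(q-1)x}$ (the statement covers both cases); $\nu^*$ denotes $-\omega$ or $q^{-1}$, respectively. For $\mathcal U\in\mathbb{P}'$, $D_\nu\mathcal U\in\mathbb{P}'$ is defined by $\langle D_\nu\mathcal U,p\rangle=-\langle\mathcal U,D_{\nu^*}p\rangle$, so that $\langle D_{\nu^*}\mathcal U,p\rangle=-\langle\mathcal U,D_{\nu}p\rangle$; powers $D^j$ denote iterates ($D^0$ the identity). A sequence $\{P_n\}_{n\ge0}$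 of monic polynomials with $\deg P_n=n$ is the sequence of monic orthogonal polynomials (SMOP) with respect to $\mathcal U$ if $\langle\mathcal U,P_nP_m\rangle=\xi_n\delta_{n,m}$ with $\xi_n\ne0$ for all $n,m\ge0$; $\mathcal U$ is regular if it has an SMOP. For a SMOP $\{P_n\}$ and $m\ge0$ the monic polynomials $P_n^{[m,\nu]}$ are $$P^{[m,\nu]}_{n}(x):=\frac{D_\nu^mP_{n+m}(x)}{\eta_{n,m,\nu}},\qquad \eta_{n,m,\omega}:=(n+1)(n+2)\cdots(n+m),\qquad \eta_{n,m,q}:=\frac{\prod_{i=1}^{m}(1-q^{n+i})}{(1-q)^m}$$ (empty products equal $1$), and similarly for $Q_n^{[k,\nu]}$. In the $q$-case, $q$ is not a root of unity, so that all $\eta_{n,m,q}$ are nonzero. Terms with negative index $n-i<0$ are understood to be zero. An empty determinant (case $M+N=0$) equals $1$. A regular functional $\mathcal U$ is $D_\nu$-semiclassical if there exist $\sigma,\tau\in\mathbb{P}$ with $\deg\tau\ge1$ such that $D_\nu(\sigma(x)\,\mathcal U)=\tau(x)\,\mathcal U$. *)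

(* Defs.v *)
From HB Require Import structures.
From mathcomp Require Import all_boot all_order all_algebra.
Set Implicit Arguments.
Unset Strict Implicit.
Unset Printing Implicit Defensive.
Import GRing.Theory.
Local Open Scope ring_scope.

(* The two operators share one parameter type: [Diff w] is nu = omega := w,
   [QDil q] is nu = q. *)
Variant param (F : Type) := Diff of F | QDil of F.
Arguments Diff {F}.
Arguments QDil {F}.

Definition admissible (F : fieldType) (nu : param F) : Prop :=
  match nu with
  | Diff w => w != 0
  | QDil q => [/\ q != 0, q != 1, q != -1
                & forall n : nat, (0 < n)%N -> q ^+ n != 1]
  end.

Definition nustar (F : fieldType) (nu : param F) : param F :=
  match nu with
  | Diff w => Diff (- w)
  | QDil q => QDil q^-1
  end.

(* In the q-case the Euclidean quotient is exact, see [D_QDil_exact]. *)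
Definition D (F : fieldType) (nu : param F) (p : {poly F}) : {poly F} :=
  match nu with
  | Diff w => w^-1 *: (p \Po ('X + w%:P) - p)
  | QDil q => (p \Po (q *: 'X) - p) %/ ((q - 1) *: 'X)
  end.

Lemma D_is_linear (F : fieldType) (nu : param F) : linear (D nu).
Proof.
case: nu => [w|q] c p r /=; rewrite comp_polyD comp_polyZ opprD addrACA -scalerBr.
  by rewrite scalerDr !scalerA mulrC.
by rewrite divpD divpZl.
Qed.

HB.instance Definition _ (F : fieldType) (nu : param F) :=
  GRing.isLinear.Build F {poly F} {poly F} *:%R (D nu) (D_is_linear nu).

Lemma D_QDil_exact (F : fieldType) (q : F) (p : {poly F}) : q != 1 ->
  D (QDil q) p * ((q - 1) *: 'X) = p \Po (q *: 'X) - p.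
Proof.
move=> q1; rewrite /= divpK // dvdpZl ?subr_eq0 //.
rewrite -[X in X %| _]subr0 -polyC0 dvdp_XsubCl rootE hornerD hornerN.
by rewrite horner_comp hornerZ hornerX mulr0 subrr.
Qed.

Definition mulF_fun (F : fieldType) (pi : {poly F}) (U : {scalar {poly F}}) :
  {poly F} -> F := fun p => U (pi * p).

Lemma mulF_is_scalar (F : fieldType) (pi : {poly F}) (U : {scalar {poly F}}) :
  scalar (mulF_fun pi U).
Proof. by move=> c p r; rewrite /mulF_fun mulrDr -scalerAr linearP. Qed.

HB.instance Definition _ (F : fieldType) (pi : {poly F})
    (U : {scalar {poly F}}) :=
  GRing.isLinear.Build F {poly F} F *%R (mulF_fun pi U) (mulF_is_scalar pi U).

(* pi(x) U *)
Definition mulF (F : fieldType) (pi : {poly F}) (U : {scalar {poly F}}) :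
  {scalar {poly F}} := mulF_fun pi U.

Definition DF_fun (F : fieldType) (nu : param F) (U : {scalar {poly F}}) :
  {poly F} -> F := fun p => - U (D (nustar nu) p).

Lemma DF_is_scalar (F : fieldType) (nu : param F) (U : {scalar {poly F}}) :
  scalar (DF_fun nu U).
Proof. by move=> c p r; rewrite /DF_fun !linearP opprD mulrN. Qed.

HB.instance Definition _ (F : fieldType) (nu : param F)
    (U : {scalar {poly F}}) :=
  GRing.isLinear.Build F {poly F} F *%R (DF_fun nu U) (DF_is_scalar nu U).

(* D_nu U; the defining formula involves D at nu^*. *)
Definition DF (F : fieldType) (nu : param F) (U : {scalar {poly F}}) :
  {scalar {poly F}} := DF_fun nu U.

Definition smop (F : fieldType) (U : {scalar {poly F}}) (P : nat -> {poly F}) :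
  Prop :=
  (forall n, P n \is monic /\ size (P n) = n.+1) /\
  exists xi : nat -> F, (forall n, xi n != 0) /\
    forall n m, U (P n * P m) = xi n * (n == m)%:R.

Definition regular (F : fieldType) (U : {scalar {poly F}}) : Prop :=
  exists P, smop U P.

Definition semiclassical (F : fieldType) (nu : param F)
    (U : {scalar {poly F}}) : Prop :=
  regular U /\
  exists sigma tau : {poly F},
    (1 < size tau)%N /\ DF nu (mulF sigma U) =1 mulF tau U.

Definition eta (F : fieldType) (nu : param F) (n m : nat) : F :=
  match nu with
  | Diff _ => \prod_(1 <= i < m.+1) (n + i)%:R
  | QDil q => (\prod_(1 <= i < m.+1) (1 - q ^+ (n + i))) / (1 - q) ^+ m
  end.

(* P_n^{[m,nu]} *)
Definition assoc (F : fieldType) (nu : param F) (m : nat)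
    (P : nat -> {poly F}) (n : nat) : {poly F} :=
  (eta nu n m)^-1 *: iter m (D nu) (P (n + m)%N).

(* The values [a 0 n] and [b 0 n] are never used, nor are [a i n] for i > M
   and [b i n] for i > N. *)
Definition coherent (F : fieldType) (nu : param F) (M N m k : nat)
    (P Q : nat -> {poly F}) (a b : nat -> nat -> F) : Prop :=
  [/\ forall n,
        assoc nu m P n
          + \sum_(1 <= i < M.+1 | (i <= n)%N) a i n *: assoc nu m P (n - i)
        = assoc nu k Q n
          + \sum_(1 <= i < N.+1 | (i <= n)%N) b i n *: assoc nu k Q (n - i),
      forall n, (0 < M <= n)%N -> a M n != 0,
      forall n, (0 < N <= n)%N -> b N n != 0,
      forall i n, (1 <= i <= M)%N -> (n < i)%N -> a i n = 0
    & forall i n, (1 <= i <= N)%N -> (n < i)%N -> b i n = 0].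

(* Implements the convention a_{0,n} = b_{0,n} = 1. *)
Definition unit0 (F : fieldType) (a : nat -> nat -> F) (i n : nat) : F :=
  if i == 0%N then 1 else a i n.

Definition Lmx (F : fieldType) (M N : nat) (a b : nat -> nat -> F) :
  'M[F]_(M + N) :=
  \matrix_(i, j)
    if (i < N)%N then
      if (i <= j <= M + i)%N then unit0 a (j - i) j else 0
    else
      if (i - N <= j <= i)%N then unit0 b (j + N - i) j else 0.

(* Main.v *)
(**
Both operators satisfy the divided difference identity
[D p * step = p \Po affine - p], with [affine] either [X + w] or [q X].

The basis [P^[m]_l] is, up to scalars, biorthogonal to the [P_(l+m) U] after
[m] summations by parts, so [D_{nu^*}^(m-k) (phi V) = psi U] holds with
[phi = sum_i alpha_i Q_(i+k)], [psi = sum_i beta_i P_(i+m)] (suitably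
normalized) as soon as [sum_i beta_i A_i = sum_i alpha_i B_i], where the [A_i]
and [B_i] are the rows of the two infinite band matrices [a_{j-i,j}] and
[b_{j-i,j}].  Nonvanishing of the determinant says that [A_0 .. A_(N-1)] and
[B_0 .. B_(M-1)] span all vectors supported on the first [M+N] columns; adding
the rows [A_N, A_(N+1), ..] one by one enlarges the support by one column each
time, and expanding [B_(M+n)] gives the required relation.

For fixed [s = m-k], the [phi] such that [D_{nu^*}^s (phi V)] is a polynomial
multiple of [U] form a subspace of finite codimension, so some nonzero [phi] has
[phi, X phi, .., X^s phi] in it.  The commutation rule
[D^(s+1) (X p) = (l^(s+1) X + c) D^(s+1) p + [s+1]_l D^s p] then lowers [s] one
step at a time: [D_{nu^*}^j (phi V)] is a multiple of [U] for every [j <= s].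
The case [j = 0] relates [U] and [V]; the case [j = 1] makes [U]
semiclassical for [nu*], hence for [nu], and Leibniz' rule transfers this to [V].
*)

Require Import Defs.
From mathcomp Require Import all_boot all_order all_algebra.
From mathcomp Require Import reals.
From mathcomp Require Import complex.
From HB Require Import structures.
From mathcomp Require Import ring.
Set Implicit Arguments.
Unset Strict Implicit.
Unset Printing Implicit Defensive.
Import GRing.Theory Num.Theory.
Local Open Scope ring_scope.

(** * Divided differences along an affine map *)

Definition slope (F : fieldType) (nu : param F) : F :=
  match nu with Diff _ => 1 | QDil q => q end.

Definition affine (F : fieldType) (nu : param F) : {poly F} :=
  match nu with Diff w => 'X + w%:P | QDil q => q *: 'X end.

Definition step (F : fieldType) (nu : param F) : {poly F} := affine nu - 'X.

(** The [q]-integer with base [slope nu]; in the difference case it is just [n]. *)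
Definition qnat (F : fieldType) (nu : param F) (n : nat) : F :=
  \sum_(i < n) slope nu ^+ i.

Section Operator.
Variables (F : numFieldType) (nu : param F).
Hypothesis adm : admissible nu.

Lemma nustarK : nustar (nustar nu) = nu.
Proof. by case: nu => x /=; rewrite ?opprK ?invrK. Qed.

Lemma admissible_nustar : admissible (nustar nu).
Proof.
case: nu adm => [w|q] /=; first by rewrite oppr_eq0.
case=> q0 q1 qN1 qX; split; rewrite ?invr_eq0 //.
- by rewrite -invr1 (inj_eq invr_inj).
- by rewrite -[-1]invrK invrN1 (inj_eq invr_inj).
- by move=> n n0; rewrite exprVn -invr1 (inj_eq invr_inj) qX.
Qed.

Lemma slope_neq0 : slope nu != 0.
Proof. by case: nu adm => [w|q] /= => [_|[]//]; rewrite oner_eq0. Qed.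

Lemma qnat_neq0 n : (0 < n)%N -> qnat nu n != 0.
Proof.
rewrite /qnat; case: nu adm => [w _|q [q0 q1 _ qX]] /= n0.
  under eq_bigr do rewrite expr1n.
  by rewrite sumr_const card_ord pnatr_eq0 -lt0n.
have := qX n n0; rewrite -subr_eq0 subrX1; apply: contraNneq => ->.
by rewrite mulr0.
Qed.

Lemma qnatS n : qnat nu n.+1 = slope nu * qnat nu n + 1.
Proof.
rewrite /qnat big_ord_recl expr0 addrC; congr (_ + _).
by rewrite mulr_sumr; apply: eq_bigr => i _; rewrite -exprS.
Qed.

Lemma affineE : affine nu = slope nu *: 'X + ((affine nu)`_0)%:P.
Proof.
case: nu => [w|q] /=; first by rewrite scale1r coefD coefX coefC /= add0r.
by rewrite coefZ coefX mulr0 addr0.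
Qed.

Lemma step_neq0 : step nu != 0.
Proof.
rewrite /step; case: nu adm => [w w0|q [q0 q1 _ _]] /=.
  by rewrite addrAC subrr add0r polyC_eq0.
rewrite -{2}['X]scale1r -scalerBl scaler_eq0 subr_eq0 (negPf q1).
by rewrite polyX_eq0.
Qed.

(** As [step nu] is nonzero, this identity determines [D nu p]: the rules for products, constants
    and ['X] follow by cancelling [step nu], with no case split. *)
Lemma D_step p : D nu p * step nu = p \Po affine nu - p.
Proof.
rewrite /step; case: nu adm => [w w0|q [q0 q1 _ _]].
  rewrite /= addrAC subrr add0r -scalerAl mulrC mul_polyC.
  by rewrite scalerA mulVf ?scale1r.
by rewrite -D_QDil_exact //= scalerBl scale1r.
Qed.

Lemma DM p r : D nu (p * r) = (p \Po affine nu) * D nu r + r * D nu p.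
Proof.
apply: (mulIf step_neq0); rewrite mulrDl -!mulrA !D_step comp_polyM; ring.
Qed.

Lemma DC c : D nu c%:P = 0.
Proof. by apply: (mulIf step_neq0); rewrite D_step comp_polyC subrr mul0r. Qed.

Lemma DX : D nu 'X = 1.
Proof. by apply: (mulIf step_neq0); rewrite D_step comp_polyX mul1r. Qed.

Lemma DXM p : D nu ('X * p) = affine nu * D nu p + p.
Proof. by rewrite DM comp_polyX DX mulr1. Qed.

Lemma affine_nustar : affine (nustar nu) \Po affine nu = 'X.
Proof.
case: nu adm => [w|q] /=.
  by rewrite comp_polyD comp_polyX comp_polyC polyCN addrK.
by case=> q0 _ _ _; rewrite comp_polyZ comp_polyX scalerA mulVf // scale1r.
Qed.

Lemma comp_affine_surj p : exists r, r \Po affine nu = p.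
Proof.
exists (p \Po affine (nustar nu)).
by rewrite -comp_polyA affine_nustar comp_polyXr.
Qed.

Lemma comp_affine_eq0 p : (p \Po affine nu == 0) = (p == 0).
Proof.
apply/eqP/eqP => [p0|->]; last by rewrite comp_poly0.
apply/eqP; move: p0 => /eqP; rewrite comp_poly_eq0 //.
case: nu adm => [w _|q [q0 _ _ _]] /=; first by rewrite size_XaddC.
by rewrite size_scale // size_polyX.
Qed.

Lemma step_comp_affine : step nu \Po affine nu = slope nu *: step nu.
Proof.
rewrite /step; case: nu => [w|q] /=.
  by rewrite comp_polyB comp_polyD comp_polyX comp_polyC scale1r; ring.
by rewrite !(comp_polyB, comp_polyZ, comp_polyX) scalerBr.
Qed.

Lemma comp_affine_inj p r : p \Po affine nu = r \Po affine nu -> p = r.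
Proof.
move=> /eqP; rewrite -subr_eq0 -comp_polyB comp_affine_eq0 subr_eq0.
by move/eqP.
Qed.

End Operator.

(** Both sides are compared after a shift by [affine nu], which turns [step (nustar nu)] into
    [- step nu]; the factor [slope nu] is the one by which [step nu] scales under that shift. *)
Lemma D_nustar_comp (F : numFieldType) (nu : param F) (p : {poly F}) :
  admissible nu -> D (nustar nu) (p \Po affine nu) = slope nu *: D nu p.
Proof.
move=> adm.
have step_nustar : step (nustar nu) \Po affine nu = - step nu.
  by rewrite /step comp_polyB affine_nustar // comp_polyX opprB.
apply: (comp_affine_inj adm); apply: (mulIf (step_neq0 adm)); apply: oppr_inj.
rewrite -mulrN -step_nustar -comp_polyM D_step; last exact: admissible_nustar.
have affineK : affine nu \Po affine (nustar nu) = 'X.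
  by have := affine_nustar (admissible_nustar adm); rewrite nustarK.
rewrite -comp_polyA affineK comp_polyXr comp_polyZ -scalerAl scalerAr.
rewrite -step_comp_affine // -comp_polyM D_step //.
by rewrite !comp_polyB opprB.
Qed.

(** * Degrees *)

Section Degree.
Variables (F : numFieldType) (nu : param F).
Hypothesis adm : admissible nu.

Lemma size_D_Xn n : (size (D nu 'X^n) <= n)%N.
Proof.
elim: n => [|n IHn]; first by rewrite expr0 DC // size_poly0.
rewrite exprS DXM // (leq_trans (size_polyD _ _)) // geq_max size_polyXn leqnn.
rewrite andbT (leq_trans (size_polyMleq _ _)) // affineE.
have le2 : (size (slope nu *: 'X + ((affine nu)`_0)%:P)%R <= 2)%N.
  rewrite (leq_trans (size_polyD _ _)) // geq_max size_scale ?slope_neq0 //.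
  by rewrite size_polyX (leq_trans (size_polyC_leq1 _)).
by rewrite -subn1 leq_subLR add1n -addn2 addnC leq_add.
Qed.

Lemma coef_D_Xn n : (D nu 'X^(n.+1))`_n = qnat nu n.+1.
Proof.
elim: n => [|n IHn]; first by rewrite expr1 DX // coefC /qnat big_ord1 expr0.
rewrite exprS DXM // qnatS -IHn affineE mulrDl -scalerAl mul_polyC !coefD !coefZ.
rewrite coefXM coefXn eqxx /= (nth_default _ (size_D_Xn _)).
by rewrite mulr0 addr0.
Qed.

(** Admissibility keeps the leading coefficients [qnat nu n.+1] of the images of the monomials
    nonzero, so a nonconstant polynomial loses exactly one degree. *)
Lemma size_D p : size (D nu p) = (size p).-1.
Proof.
have sizeXn n : size (D nu 'X^(n.+1)) = n.+1.
  apply/eqP; rewrite eqn_leq size_D_Xn ltnNge; apply/negP => le_n.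
  by have /eqP := coef_D_Xn n; rewrite nth_default // eq_sym (negPf (qnat_neq0 _ _)).
have [->|p0] := eqVneq p 0; first by rewrite linear0 size_poly0.
have := p0; rewrite -lead_coef_eq0 lead_coefE -[p in D nu p]coefK poly_def.
have := p0; rewrite -size_poly_gt0; case: (size p) => // [[|n]] _ /= lp0.
  by rewrite big_ord1 expr0 linearZ /= DC // scaler0 size_poly0.
rewrite big_ord_recr /= linearD linearZ /= addrC size_polyDl size_scale // sizeXn //.
rewrite linear_sum (leq_ltn_trans (size_sum _ _ _)) // ltnS.
apply/bigmax_leqP => i _; rewrite linearZ /= (leq_trans (size_scale_leq _ _)) //.
by rewrite (leq_trans (size_D_Xn _)) // -ltnS.
Qed.

Lemma size_iterD s p : size (iter s (D nu) p) = (size p - s)%N.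
Proof. by elim: s => [|s IHs] /=; rewrite ?subn0 // size_D IHs subnS. Qed.

End Degree.

Lemma iterD_is_linear (F : fieldType) (nu : param F) s : linear (iter s (D nu)).
Proof. by elim: s => [|s IHs] c p r //=; rewrite IHs linearP. Qed.

HB.instance Definition _ (F : fieldType) (nu : param F) (s : nat) :=
  GRing.isLinear.Build F {poly F} {poly F} *:%R (iter s (D nu))
    (iterD_is_linear nu s).

(** * Graded bases and orthogonality *)

Lemma size_cancel_lead (F : fieldType) n (p r : {poly F}) :
  (size p <= n.+1)%N -> size r = n.+1 ->
  (size (p - (p`_n / lead_coef r) *: r)%R <= n)%N.
Proof.
move=> le_p size_r; apply/leq_sizeP => j; rewrite leq_eqVlt coefB coefZ.
case/predU1P=> [<-|lt_nj]; last first.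
  rewrite (nth_default _ (leq_trans le_p lt_nj)) [r`_j]nth_default ?size_r //.
  by rewrite mulr0 subrr.
have lr0 : lead_coef r != 0 by rewrite lead_coef_eq0 -size_poly_gt0 size_r.
by move: lr0; rewrite lead_coefE size_r /= => lr0; rewrite divfK ?subrr.
Qed.

Section Graded.
Variables (F : fieldType) (B : nat -> {poly F}).
Hypothesis sizeB : forall n, size (B n) = n.+1.

Lemma graded_span n (p : {poly F}) : (size p <= n)%N ->
  exists c : nat -> F, p = \sum_(i < n) c i *: B i.
Proof.
elim: n p => [|n IHn] p.
  by rewrite leqn0 size_poly_eq0 => /eqP ->; exists (fun=> 0); rewrite big_ord0.
move=> le_p; have [c def_p] := IHn _ (size_cancel_lead le_p (sizeB n)).
set t := _ / _ in def_p.
exists (fun i => if i == n then t else c i); rewrite big_ord_recr /= eqxx.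
rewrite -[LHS](subrK (t *: B n)) def_p; congr (_ + _).
by apply: eq_bigr => i _; rewrite ltn_eqF.
Qed.

Lemma graded_eq (W1 W2 : {scalar {poly F}}) n (p : {poly F}) :
  (forall i, (i < n)%N -> W1 (B i) = W2 (B i)) -> (size p <= n)%N -> W1 p = W2 p.
Proof.
move=> eqW /graded_span[c ->]; rewrite !linear_sum; apply: eq_bigr => i _.
by rewrite !linearZ /= eqW.
Qed.

Lemma size_graded_sum s n (c : nat -> F) : c n != 0 ->
  size (\sum_(i < n.+1) c i *: B (i + s)) = (n + s).+1.
Proof.
move=> cn0; rewrite big_ord_recr /= addrC size_polyDl size_scale ?sizeB //.
rewrite ltnS (leq_trans (size_sum _ _ _)) //; apply/bigmax_leqP => i _.
by rewrite (leq_trans (size_scale_leq _ _)) // sizeB ltn_add2r.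
Qed.

End Graded.

Section Regular.
Variables (F : fieldType) (U : {scalar {poly F}}) (P : nat -> {poly F}).
Hypothesis smopU : smop U P.

Lemma size_smop n : size (P n) = n.+1.
Proof. by case: smopU => /(_ n)[]. Qed.

Lemma smop_orth n (p : {poly F}) : (size p <= n)%N -> U (P n * p) = 0.
Proof.
move=> le_p; case: smopU => _ [xi [_ orthP]].
apply: (graded_eq size_smop (W1 := mulF (P n) U) (W2 := \0) _ le_p) => i lt_in.
by rewrite /= /mulF_fun orthP gtn_eqF ?mulr0.
Qed.

(** For [p] nonzero, pairing with the [P n] of the same degree leaves the leading coefficient of [p]
    times [xi n], which is nonzero. *)
Lemma regular_mul_eq0 (p : {poly F}) : (forall r, U (p * r) = 0) -> p = 0.
Proof.
move=> Up0; apply/eqP/negPn/negP => p0; have := Up0 (P (size p).-1).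
case: smopU => monP [xi [xi0 orthP]].
have /smop_orth := size_cancel_lead (leqSpred (size p)) (size_smop _).
rewrite mulrBr linearB -scalerAr linearZ /= orthP eqxx mulr1.
rewrite mulrC => /subr0_eq -> /eqP; rewrite mulf_eq0 (negPf (xi0 _)) orbF.
by rewrite (monicP _) ?(monP _).1 // divr1 -lead_coefE lead_coef_eq0 (negPf p0).
Qed.

End Regular.

(** * Pearson equations *)

Section Pearson.
Variables (F : numFieldType) (nu : param F) (U : {scalar {poly F}}).
Hypothesis adm : admissible nu.

Lemma smop_one_neq0 P : smop U P -> U 1 != 0.
Proof.
move=> smopU; have sizeP0 := size_smop smopU 0.
case: smopU => monP [xi [xi0 orthP]].
have P01 : P 0%N = 1.
  have /monicP := (monP 0%N).1; rewrite lead_coefE sizeP0 /= => lP.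
  by rewrite [LHS]size1_polyC ?sizeP0 // lP.
by have := orthP 0%N 0%N; rewrite eqxx mulr1 P01 mulr1 => ->.
Qed.

(** Testing on [1], which [D] kills, shows that a constant [tau] is zero. Then [sigma U] vanishes on
    the images of the powers of ['X], which form a graded basis, and regularity forces
    [sigma = 0]. *)
Lemma pearson_degree (sigma tau : {poly F}) : regular U -> sigma != 0 ->
  DF nu (mulF sigma U) =1 mulF tau U -> (1 < size tau)%N.
Proof.
case=> P smopU sigma0 eqU; have admS := admissible_nustar adm.
rewrite ltnNge; apply: contra sigma0 => le_tau; have tauC := size1_polyC le_tau.
have tau0 : tau = 0.
  have := eqU 1; rewrite /= /DF_fun /= -[X in D _ X]polyC1 DC // linear0 oppr0.
  rewrite /mulF_fun mulr1 tauC -[_%:P]mulr1 mul_polyC linearZ /= => /esym/eqP.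
  by rewrite mulf_eq0 (negPf (smop_one_neq0 smopU)) orbF => /eqP ->; rewrite scale0r.
apply/eqP/(regular_mul_eq0 smopU) => p.
have sizeDX n : size (D (nustar nu) 'X^(n.+1)) = n.+1 by rewrite size_D // size_polyXn.
apply: (graded_eq sizeDX (W1 := mulF sigma U) (W2 := \0) _ (leqnn (size p))) => i _.
have /eqP := eqU 'X^(i.+1); rewrite /= /DF_fun /mulF_fun tau0 mul0r linear0.
by rewrite oppr_eq0 => /eqP.
Qed.

Lemma pearson_neq0 (sigma tau : {poly F}) : regular U -> (1 < size tau)%N ->
  DF nu (mulF sigma U) =1 mulF tau U -> sigma != 0.
Proof.
case=> P smopU size_tau eqU; apply: contraTneq size_tau => sigma0.
rewrite (@regular_mul_eq0 _ _ _ smopU tau) ?size_poly0 // => p.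
by have := eqU p; rewrite /= /DF_fun /= /mulF_fun sigma0 mul0r linear0 oppr0.
Qed.

Lemma semiclassical_nustar : semiclassical nu U -> semiclassical (nustar nu) U.
Proof.
case=> regU [sigma [tau [size_tau eqU]]]; split=> //.
(* Substitute [p \Po affine nu = p + D nu p * step nu] in the Pearson equation. *)
exists (slope nu *: sigma + tau * step nu), tau; split=> // p.
have := eqU (p \Po affine nu).
rewrite /= /DF_fun /= /mulF_fun nustarK D_nustar_comp //.
rewrite -[p \Po affine nu](subrK p) -D_step // => eqp.
have -> : (slope nu *: sigma + tau * step nu) * D nu p =
    sigma * (slope nu *: D nu p) + tau * (D nu p * step nu + p) - tau * p.
  by rewrite -mul_polyC -[_ *: D nu p]mul_polyC; ring.
by rewrite linearB linearD /= -eqp subrr sub0r opprK.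
Qed.

End Pearson.

Lemma semiclassical_transfer (F : numFieldType) (nu : param F)
    (U V : {scalar {poly F}}) (phi psi : {poly F}) :
  admissible nu ->
  regular V -> phi != 0 -> psi != 0 -> mulF phi V =1 mulF psi U ->
  semiclassical nu U -> semiclassical nu V.
Proof.
move=> adm regV phi0 psi0 eqVU [regU [sigma [tau [size_tau eqU]]]]; split=> //.
have sigma0 := pearson_neq0 regU size_tau eqU.
have admS := admissible_nustar adm.
(* Multiplying [sigma U] by the shift of [h * psi], where the shift of [h] is [psi],
   makes both sides of the Leibniz rule multiples of [psi U = phi V]. *)
have [h def_h] := comp_affine_surj admS psi.
pose S := (psi \Po affine (nustar nu)) * sigma * phi.
pose T := phi * (tau * h + sigma * (D (nustar nu) psi + D (nustar nu) h)).
have S0 : S != 0 by rewrite !mulf_neq0 // comp_affine_eq0.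
suff eqV : DF nu (mulF S V) =1 mulF T V.
  by exists S, T; split=> //; apply: (pearson_degree adm regV S0).
move=> p; have eqp := eqU (h * psi * p).
rewrite /= /DF_fun /= /mulF_fun !DM // comp_polyM def_h in eqp.
rewrite /= /DF_fun /= /mulF_fun.
have eqVU' r : V (phi * r) = U (psi * r) := eqVU r.
have -> : S * D (nustar nu) p =
    phi * (sigma * (psi \Po affine (nustar nu)) * D (nustar nu) p).
  by rewrite /S; ring.
rewrite /T -[phi * _ * p]mulrA !eqVU'.
apply/eqP; rewrite -subr_eq0 -opprD oppr_eq0 -linearD /=.
have -> : psi * (sigma * (psi \Po affine (nustar nu)) * D (nustar nu) p) +
    psi * ((tau * h + sigma * (D (nustar nu) psi + D (nustar nu) h)) * p) =
  sigma * (psi * (psi \Po affine (nustar nu)) * D (nustar nu) p +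
    p * (psi * D (nustar nu) psi + psi * D (nustar nu) h)) + tau * (h * psi * p).
  by ring.
by rewrite linearD /= -eqp subrr.
Qed.

(** * Lowering the order *)

Section Reach.
Variables (F : numFieldType) (nu : param F) (U V : {scalar {poly F}}).
Hypothesis adm : admissible nu.

(* [D_{nu^*}^s (phi V)] is, up to sign, a polynomial multiple of [U]. *)
Definition reach s (phi : {poly F}) :=
  exists psi : {poly F}, forall p, V (phi * iter s (D nu) p) = U (psi * p).

Lemma reach_linear s c (phi1 phi2 : {poly F}) :
  reach s phi1 -> reach s phi2 -> reach s (c *: phi1 + phi2).
Proof.
case=> psi1 eq1 [psi2 eq2]; exists (c *: psi1 + psi2) => p.
by rewrite !mulrDl -!scalerAl !linearP /= eq1 eq2.
Qed.

(** By Leibniz' rule each further [D] also differentiates the linear factor; the slopes so produced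
    accumulate to the [qnat] coefficient. *)
Lemma iterD_XM s : exists c, forall p, iter s.+1 (D nu) ('X * p) =
  (slope nu ^+ s.+1 *: 'X + c%:P) * iter s.+1 (D nu) p
    + qnat nu s.+1 *: iter s (D nu) p.
Proof.
elim: s => [|s [c IHs]].
  exists (affine nu)`_0 => p.
  by rewrite /= DXM // expr1 -affineE // /qnat big_ord1 expr0 scale1r.
exists (slope nu ^+ s.+1 * (affine nu)`_0 + c) => p.
have -> : iter s.+2 (D nu) ('X * p) = D nu (iter s.+1 (D nu) ('X * p)) by [].
rewrite IHs; set g := iter s.+1 (D nu) p.
have -> : iter s.+2 (D nu) p = D nu g by [].
rewrite linearD linearZ /= -/(iter s.+1 (D nu) p) -/g DM // [D nu (_ + _)]linearD.
rewrite linearZ /= DC // DX // addr0 comp_polyD comp_polyZ comp_polyX comp_polyC.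
move: (affineE nu); set a0 := (affine nu)`_0 => ->.
rewrite {2}/qnat big_ord_recr -/(qnat nu s.+1) /=.
rewrite [slope nu ^+ s.+2]exprS; set l := slope nu ^+ s.+1.
rewrite scalerDl -!mul_polyC !rmorphD !rmorphM /=; ring.
Qed.

(** Testing the relation for [phi] on ['X * p] and expanding by [iterD_XM] isolates the term of
    order [s], whose coefficient [qnat nu s.+1] is invertible. *)
Lemma reach_pred s (phi : {poly F}) :
  reach s.+1 phi -> reach s.+1 ('X * phi) -> reach s phi.
Proof.
case=> psi eq0 [psi1 eq1]; have [c iterX] := iterD_XM s.
exists ((qnat nu s.+1)^-1 *: (psi * 'X - slope nu ^+ s.+1 *: psi1 - c *: psi)) => p.
have := eq0 ('X * p); rewrite iterX.
move: (iter s _ p) (iter s.+1 _ p) (eq0 p) (eq1 p) => f g eqg eqg1.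
have -> : phi * ((slope nu ^+ s.+1 *: 'X + c%:P) * g + qnat nu s.+1 *: f) =
    slope nu ^+ s.+1 *: ('X * phi * g) + c *: (phi * g) + qnat nu s.+1 *: (phi * f).
  by rewrite -!mul_polyC; ring.
rewrite !(linearD V) !(linearZ_LR V) /= eqg eqg1 => eqf.
apply: (mulfI (qnat_neq0 adm (ltn0Sn s))); rewrite -scalerAl (linearZ_LR U) /= mulVKf.
  by rewrite !mulrBl -!scalerAl !(linearB U) !(linearZ_LR U) /= -mulrA -eqf; ring.
exact: qnat_neq0.
Qed.

(** Lowering the order by one costs one power of ['X]: [reach_pred] is applied to every ['X^i * phi]
    with [i <= s]. *)
Lemma reach_le s (phi : {poly F}) : (forall i, (i <= s)%N -> reach s ('X^i * phi)) ->
  forall j, (j <= s)%N -> reach j phi.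
Proof.
elim: s => [|s IHs] reachX j.
  by rewrite leqn0 => /eqP ->; have := reachX 0%N (leqnn _); rewrite expr0 mul1r.
rewrite leq_eqVlt => /predU1P[->|lt_js].
  by have := reachX 0%N (leq0n _); rewrite expr0 mul1r.
apply: IHs lt_js => i le_is; apply: reach_pred; first exact/reachX/leqW.
by rewrite mulrA -exprS; apply: reachX.
Qed.

End Reach.

(** * Subspaces of finite codimension *)

Section FiniteCodimension.
Variables (F : fieldType) (S : {poly F} -> Prop) (d : nat).
Hypothesis S_linear : forall c (p r : {poly F}), S p -> S r -> S (c *: p + r).
Hypothesis S_size : forall n, exists2 p : {poly F}, size p = (d + n).+1 & S p.

Lemma subspace0 : S 0.
Proof.
by have [p _ Sp] := S_size 0; have := S_linear (-1) Sp Sp; rewrite scaleN1r addNr.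
Qed.

(** Division with remainder: [S] has an element of each degree at least [d], which serves to cancel
    leading terms. *)
Lemma subspace_rem (p : {poly F}) : exists2 r : {poly F}, (size r <= d)%N & S (p - r).
Proof.
have [n] := ubnP (size p); elim: n p => // n IHn p; rewrite ltnS => le_pn.
have [le_pd|] := leqP (size p) d; first by exists p; rewrite // subrr; apply: subspace0.
case def_p: (size p) le_pn => [//|e] le_en; rewrite ltnS => le_de.
have [t size_t St] := S_size (e - d); rewrite subnKC // in size_t.
have le_pe : (size p <= e.+1)%N by rewrite def_p.
have [|r le_r Sr] := IHn (p - (p`_e / lead_coef t) *: t).
  by rewrite (leq_ltn_trans (size_cancel_lead le_pe size_t)).
exists r => //; have := S_linear (p`_e / lead_coef t) St Sr.
by rewrite addrA addrCA subrr addr0.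
Qed.

Lemma subspace_sum (I : Type) (l : seq I) (c : I -> F) (p : I -> {poly F}) :
  (forall i, S (p i)) -> S (\sum_(i <- l) c i *: p i).
Proof.
move=> Sp; elim: l => [|i l IHl]; first by rewrite big_nil; apply: subspace0.
by rewrite big_cons; apply: S_linear.
Qed.

(** Reducing modulo [S], the conditions follow from [s.+1 * d] homogeneous linear equations on the
    coefficients of [p]; [K] unknowns are one more than that. *)
Lemma finite_codim_XM s :
  exists2 p : {poly F}, p != 0 & forall i, (i <= s)%N -> S ('X^i * p).
Proof.
pose K := (s.+1 * d).+1.
have [r r_rem] : exists r : 'I_(s + K) -> {poly F},
    forall j, (size (r j) <= d)%N /\ S ('X^j - r j).
  have rem (j : 'I_(s + K)) : exists r : {poly F}, (size r <= d)%N /\ S ('X^j - r).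
    by have [r le_r Sr] := subspace_rem 'X^j; exists r.
  exact: fin_all_exists rem.
have lt_sK (i : 'I_s.+1) (j : 'I_K) : (i + j < s + K)%N.
  by rewrite -addnS leq_add // -ltnS.
pose rr i j := r (Ordinal (lt_sK i j)).
(* Row [j] lists the coefficients of the remainders of ['X^(i + j)] for all [i <= s]. *)
pose G : 'M[F]_(K, s.+1 * d) :=
  \matrix_j mxvec (\matrix_(i < s.+1, t < d) (rr i j)`_t).
have [u u0 uG] : exists2 u : 'rV_K, u != 0 & u *m G = 0.
  have : kermx G != 0.
    rewrite kermx_eq0 /row_free neq_ltn (leq_ltn_trans (rank_leq_col _)) //.
  by case/rowV0Pn=> u /sub_kermxP uG u0; exists u.
exists (\sum_(j < K) u 0 j *: 'X^j).
  apply: contraNneq u0 => sum0; apply/eqP/rowP => j.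
  have /(congr1 (fun p : {poly F} => p`_j)) := sum0.
  rewrite coef_sum (bigD1 j) //= coefZ coefXn eqxx mulr1 big1 => [|l neq_lj].
    by rewrite addr0 coef0 mxE.
  by rewrite coefZ coefXn eq_sym val_eqE (negPf neq_lj) mulr0.
move=> i; rewrite -ltnS => lt_is; pose oi := Ordinal lt_is.
have rem0 : \sum_j u 0 j *: rr oi j = 0.
  apply/polyP => t; rewrite coef0 coef_sum.
  have [lt_td|le_dt] := ltnP t d; last first.
    rewrite big1 // => j _; rewrite coefZ nth_default ?mulr0 //.
    by rewrite (leq_trans (r_rem _).1).
  have /rowP/(_ (mxvec_index oi (Ordinal lt_td))) := uG.
  rewrite !mxE => sum0; rewrite -[RHS]sum0; apply: eq_bigr => j _.
  by rewrite mxE mxvecE mxE coefZ.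
have -> : 'X^i * (\sum_(j < K) u 0 j *: 'X^j) =
    \sum_j u 0 j *: ('X^(i + j) - rr oi j).
  under [RHS]eq_bigr do rewrite scalerBr.
  rewrite sumrB rem0 subr0 mulr_sumr; apply: eq_bigr => j _.
  by rewrite -scalerAr exprD.
by apply: subspace_sum => j; apply: (r_rem (Ordinal (lt_sK oi j))).2.
Qed.

End FiniteCodimension.

(** * Band matrices *)

(* [band M a i] is the [i]-th row of the infinite matrix [a_{j-i,j}]; the first [N]
   rows of [Lmx] are those of [band M a], the others those of [band N b]. *)
Definition band (F : fieldType) (M : nat) (a : nat -> nat -> F) (i j : nat) : F :=
  if (i <= j <= M + i)%N then unit0 a (j - i) j else 0.

Section Band.
Variables (F : fieldType) (M N : nat) (a b : nat -> nat -> F).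
Hypothesis aM : forall n, (0 < M <= n)%N -> a M n != 0.
Hypothesis bN : forall n, (0 < N <= n)%N -> b N n != 0.
Hypothesis detL : \det (Lmx M N a b) != 0.

Lemma band_eq0 (K : nat) (c : nat -> nat -> F) i j : (K + i < j)%N -> band K c i j = 0.
Proof. by move=> lt_ij; rewrite /band [(j <= _)%N]leqNgt lt_ij andbF. Qed.

(** When [K = 0] the last entry is the diagonal one, equal to [1] by the convention in [unit0]. *)
Lemma band_last_neq0 (K : nat) (c : nat -> nat -> F) i :
  (forall n, (0 < K <= n)%N -> c K n != 0) -> band K c i (K + i) != 0.
Proof.
move=> cK; rewrite /band leqnn leq_addl addnK /unit0 /=.
have [_|] := posnP K; first by rewrite oner_eq0.
by move=> K0; rewrite cK // K0 leq_addr.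
Qed.

Lemma Lmx_span (r : nat -> F) : (forall j, (M + N <= j)%N -> r j = 0) ->
  exists beta alpha : nat -> F, forall j,
    r j = \sum_(i < N) beta i * band M a i j + \sum_(i < M) alpha i * band N b i j.
Proof.
move=> r0; have [u uL] : exists u, u *m Lmx M N a b = \row_j r j.
  by exists ((\row_j r j) *m invmx (Lmx M N a b)); rewrite mulmxKV // unitmxE unitfE.
(* The solution [u], extended by zero to all indices: its first [N] entries weight the rows of [a],
   the next [M] those of [b]. *)
pose c i := oapp (u 0) 0 (insub i : option 'I_(M + N)).
exists c, (fun i => c (N + i)%N) => j.
have [le_j|lt_j] := leqP (M + N) j.
  rewrite r0 // !big1 ?addr0 // => i _; rewrite band_eq0 ?mulr0 //.
    by rewrite (leq_trans _ le_j) // addnC ltn_add2r.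
  by rewrite (leq_trans _ le_j) // ltn_add2l.
have /rowP/(_ (Ordinal lt_j)) := uL; rewrite !mxE => <- /=.
pose f i := c i * (if (i < N)%N then band M a i j else band N b (i - N) j).
transitivity (\sum_(i < M + N) f i).
  apply: eq_bigr => i _; rewrite mxE /f /c valK /=; congr (_ * _).
  have [//|le_Ni] := ltnP i N.
  by rewrite /band subnKC // subnBA.
rewrite addnC big_split_ord /=; congr (_ + _); apply: eq_bigr => i _.
  by rewrite /f ltn_ord.
by rewrite /f ltnNge leq_addr /= addKn.
Qed.

Lemma band_span n (r : nat -> F) : (forall j, (M + N + n <= j)%N -> r j = 0) ->
  exists beta alpha : nat -> F, forall j,
    r j = \sum_(i < N + n) beta i * band M a i j
      + \sum_(i < M) alpha i * band N b i j.
Proof.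
elim: n r => [|n IHn] r r0.
  by rewrite addn0; apply: Lmx_span => j; rewrite -[(M + N)%N]addn0; apply: r0.
have last0 := band_last_neq0 (N + n) aM.
(* This multiple of the new row clears column [M + N + n], where that row has its last nonzero
   entry. *)
pose t := r (M + (N + n))%N / band M a (N + n) (M + (N + n)).
have [|beta [alpha eq_r]] := IHn (fun j => r j - t * band M a (N + n) j).
  move=> j; rewrite leq_eqVlt -addnA => /predU1P[<-|lt_j].
    by rewrite divfK ?subrr.
  by rewrite band_eq0 // mulr0 subr0 r0 // addnS -addnA.
exists (fun i => if i == (N + n)%N then t else beta i), alpha => j.
rewrite addnS big_ord_recr /= eqxx addrAC; apply/eqP; rewrite -subr_eq eq_r.
apply/eqP; congr (_ + _); apply: eq_bigr => i _.
by rewrite ltn_eqF.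
Qed.

Lemma band_relation n : exists beta alpha : nat -> F,
  [/\ beta (N + n)%N != 0, alpha (M + n)%N != 0
    & forall j, \sum_(i < (N + n).+1) beta i * band M a i j
              = \sum_(i < (M + n).+1) alpha i * band N b i j].
Proof.
have lastA := band_last_neq0 (N + n) aM; have lastB := band_last_neq0 (M + n) bN.
(* Both rows end in column [M + N + n], so [t] cancels the last entry of the [b] row; it is nonzero
   because both end entries are. *)
pose t := band N b (M + n) (N + (M + n)) / band M a (N + n) (M + (N + n)).
have [|beta [alpha eq_r]] :=
    @band_span n (fun j => band N b (M + n) j - t * band M a (N + n) j).
  move=> j; rewrite leq_eqVlt -addnA => /predU1P[<-|lt_j].
    by rewrite divfK // addnCA subrr.
  by rewrite !band_eq0 ?mulr0 ?subrr // addnCA.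
exists (fun i => if i == (N + n)%N then t else beta i).
exists (fun i => if i == (M + n)%N then 1 else if (i < M)%N then - alpha i else 0).
rewrite !eqxx oner_eq0; split=> // [|j]; first by rewrite mulf_neq0 ?invr_neq0.
rewrite !big_ord_recr /= !eqxx mul1r.
under eq_bigr => i _ do rewrite (ltn_eqF (ltn_ord i)).
rewrite [in RHS]big_split_ord /= [X in _ = _ + X + _]big1 => [|i _].
  under [X in _ = X + _ + _]eq_bigr => i _.
    rewrite ltn_eqF ?ltn_addr ?ltn_ord // mulNr; over.
  by rewrite sumrN addr0 -[band N b _ j](subrK (t * band M a (N + n) j)) eq_r; ring.
by rewrite eqn_add2l ltn_eqF // ltnNge leq_addr mul0r.
Qed.

End Band.

(** Substituting [l = n - i] turns one side of the coherence relation into column [n] of the band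
    matrix, which vanishes below row [n]; hence any bound [J > n] will do. *)
Lemma sum_band (F : fieldType) (M : nat) (a : nat -> nat -> F)
    (T : nat -> {poly F}) n J : (n < J)%N ->
  T n + \sum_(1 <= i < M.+1 | (i <= n)%N) a i n *: T (n - i)%N
  = \sum_(l < J) band M a l n *: T l.
Proof.
move=> lt_nJ.
have -> : T n + \sum_(1 <= i < M.+1 | (i <= n)%N) a i n *: T (n - i)%N =
    \sum_(0 <= i < M.+1 | (i <= n)%N) unit0 a i n *: T (n - i)%N.
  rewrite [RHS]big_ltn_cond //= /unit0 eqxx scale1r subn0; congr (_ + _).
  by rewrite big_nat_cond [RHS]big_nat_cond; apply: eq_bigr => -[].
rewrite -(big_mkord xpredT (fun l => band M a l n *: T l)).
rewrite [RHS](@big_cat_nat _ _ _ n.+1) //= [X in _ = _ + X]big_nat_cond.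
rewrite [X in _ = _ + X]big1 => [|i]; last first.
  by rewrite andbT => /andP[lt_ni _]; rewrite /band leqNgt lt_ni scale0r.
rewrite addr0 [RHS]big_nat_rev /= add0n.
rewrite (big_nat_widen _ _ (maxn M.+1 n.+1)) ?leq_maxl //.
rewrite [RHS](big_nat_widen _ _ (maxn M.+1 n.+1)) ?leq_maxr //.
rewrite big_mkcond [RHS]big_mkcond; apply: eq_bigr => i _ /=.
rewrite !ltnS subSS; case: (leqP i n) => //= le_in.
rewrite /band leq_subr /= subKn // addnBA //.
rewrite (leq_subRL _ (leq_trans le_in (leq_addl M n))).
by rewrite leq_add2r; case: ifP; rewrite ?scale0r.
Qed.

(** * Coherent pairs *)

Section Coherent.
Variables (F : numFieldType) (nu : param F).
Hypothesis adm : admissible nu.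

Lemma eta_neq0 n m : Defs.eta nu n m != 0.
Proof.
case: nu adm => [w _|q [q0 q1 _ qX]] /=.
  rewrite prodf_seq_neq0; apply/allP => i; rewrite mem_index_iota => /andP[i0 _].
  by rewrite pnatr_eq0 -lt0n addn_gt0 i0 orbT.
rewrite mulf_neq0 //; last by rewrite invr_neq0 // expf_neq0 // subr_eq0 eq_sym.
rewrite prodf_seq_neq0; apply/allP => i; rewrite mem_index_iota => /andP[i0 _].
by rewrite subr_eq0 eq_sym qX // addn_gt0 i0 orbT.
Qed.

Lemma size_assoc m U P n : smop U P -> size (assoc nu m P n) = n.+1.
Proof.
move=> smopU; rewrite size_scale ?invr_eq0 ?eta_neq0 // size_iterD //.
by rewrite (size_smop smopU) -addSn addnK.
Qed.

(** Biorthogonality: [p] and the sum of the [(c l / eta nu l m) *: P (l + m)] have the same image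
    under [D^m], so they differ by a polynomial of size at most [m], to which every [P (i + m)] is
    orthogonal. *)
Lemma smop_assoc_dual m U P (beta : nat -> F) K : smop U P -> beta K != 0 ->
  exists2 psi : {poly F}, size psi = (K + m).+1 &
    forall p L (c : nat -> F), (K < L)%N ->
      iter m (D nu) p = \sum_(l < L) c l *: assoc nu m P l ->
      U (psi * p) = \sum_(i < K.+1) beta i * c i.
Proof.
move=> smopU beta0; have [_ [xi [xi0 orthP]]] := smopU.
have coefU p L (c : nat -> F) i : (i < L)%N ->
    iter m (D nu) p = \sum_(l < L) c l *: assoc nu m P l ->
    U (P (i + m)%N * p) = c i * (xi (i + m)%N / Defs.eta nu i m).
  move=> lt_iL eq_p; pose r := \sum_(l < L) (c l / Defs.eta nu l m) *: P (l + m)%N.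
  have : U (P (i + m)%N * (p - r)) = 0.
    apply: (smop_orth smopU); apply: leq_trans (leq_addl i m).
    rewrite -subn_eq0 -(size_iterD adm) linearB /= eq_p linear_sum /= -sumrB.
    rewrite big1 ?size_poly0 // => l _.
    by rewrite [iter _ _ (_ *: _)]linearZ /= /assoc scalerA subrr.
  rewrite mulrBr linearB /= => /subr0_eq ->; rewrite mulr_sumr linear_sum /=.
  rewrite (bigD1 (Ordinal lt_iL)) //= big1 ?addr0 => [|l neq_li].
    by rewrite -scalerAr linearZ /= orthP eqxx mulr1; ring.
  rewrite -scalerAr linearZ /= orthP eqn_add2r eq_sym.
  by rewrite (negPf (neq_li : l != i :> nat)) !mulr0.
(* These weights undo the factor in [coefU]. *)
pose w i := beta i * (Defs.eta nu i m / xi (i + m)%N).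
exists (\sum_(i < K.+1) w i *: P (i + m)%N).
  apply: size_graded_sum; first exact: size_smop smopU.
  by rewrite !mulf_neq0 ?invr_neq0 ?eta_neq0.
move=> p L c lt_KL eq_p; rewrite mulr_suml linear_sum /=; apply: eq_bigr => i _.
rewrite -scalerAl linearZ /= (coefU _ _ _ _ _ eq_p) ?(leq_trans (ltn_ord i)) //.
by rewrite /w; field; rewrite xi0 eta_neq0.
Qed.

(** Expanding [D^m p] in the common values [R j] of the two sides of the coherence relation reduces
    both pairings to columns of the two band matrices, matched by [band_relation]. *)
Lemma coherent_reach M N m k (U V : {scalar {poly F}}) P Q a b n :
  (k <= m)%N -> smop U P -> smop V Q -> coherent nu M N m k P Q a b ->
  \det (Lmx M N a b) != 0 ->
  exists phi psi : {poly F}, [/\ size phi = (M + k + n).+1,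
    size psi = (N + m + n).+1
    & forall p, V (phi * iter (m - k) (D nu) p) = U (psi * p)].
Proof.
move=> le_km smopU smopV [cohPQ aM bN _ _] detL.
have [beta [alpha [beta0 alpha0 eqAB]]] := band_relation aM bN detL n.
have [psi size_psi psiE] := smop_assoc_dual m smopU beta0.
have [phi size_phi phiE] := smop_assoc_dual k smopV alpha0.
exists phi, psi; split; rewrite ?size_phi ?size_psi 1?addnAC // => p.
pose R j := \sum_(l < j.+1) band M a l j *: assoc nu m P l.
have sizeR j : size (R j) = j.+1.
  have size_sumR :=
    @size_graded_sum _ _ (fun n => size_assoc m n smopU) 0 j (band M a ^~ j).
  rewrite addn0 in size_sumR; rewrite -[RHS]size_sumR; last first.
    by rewrite /band leqnn leq_addl subnn oner_eq0.
  by under [in RHS]eq_bigr do rewrite addn0.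
(* Large enough to expand [D^m p] and to cover every index in [phi] and [psi]. *)
pose J := maxn (size (iter m (D nu) p)) (maxn (N + n).+1 (M + n).+1).
have [d def_d] := graded_span sizeR (leq_maxl _ _ : (size (iter m (D nu) p) <= J)%N).
rewrite (phiE _ J (fun l => \sum_(j < J) d j * band N b l j)); first last.
- rewrite -iterD subnKC // def_d; under [RHS]eq_bigr do rewrite scaler_suml.
  rewrite [RHS]exchange_big; apply: eq_bigr => j _ /=.
  rewrite /R -(sum_band _ _ _ (ltnSn j)).
  rewrite cohPQ (sum_band _ _ _ (ltn_ord j)) scaler_sumr.
  by apply: eq_bigr => l _; rewrite scalerA.
- by rewrite /J !leq_max leqnn !orbT.
rewrite (psiE _ J (fun l => \sum_(j < J) d j * band M a l j)); first last.
- rewrite def_d; under [RHS]eq_bigr do rewrite scaler_suml.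
  rewrite [RHS]exchange_big; apply: eq_bigr => j _ /=.
  rewrite /R -(sum_band _ _ _ (ltnSn j)).
  rewrite (sum_band _ _ _ (ltn_ord j)) scaler_sumr.
  by apply: eq_bigr => l _; rewrite scalerA.
- by rewrite /J !leq_max leqnn !orbT.
transitivity (\sum_(j < J) d j * \sum_(i < (M + n).+1) alpha i * band N b i j).
  under eq_bigr do rewrite mulr_sumr; rewrite exchange_big.
  by apply: eq_bigr => j _; rewrite mulr_sumr; apply: eq_bigr => i _; rewrite mulrCA.
transitivity (\sum_(j < J) d j * \sum_(i < (N + n).+1) beta i * band M a i j).
  by apply: eq_bigr => j _; rewrite eqAB.
under [RHS]eq_bigr do rewrite mulr_sumr; rewrite [RHS]exchange_big.
by apply: eq_bigr => j _; rewrite mulr_sumr; apply: eq_bigr => i _; rewrite mulrCA.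
Qed.

Lemma iter_DF_nustar s (W : {scalar {poly F}}) p :
  iter s (DF (nustar nu)) W p = (-1) ^+ s * W (iter s (D nu) p).
Proof.
elim: s p => [|s IHs] p; first by rewrite mul1r.
by rewrite iterS iterSr /= /DF_fun nustarK IHs exprS mulN1r mulNr.
Qed.

End Coherent.

Theorem theorem3p2 (R : realType) (nu : param R[i]) (M N m k : nat)
    (U V : {scalar {poly R[i]}}) (P Q : nat -> {poly R[i]})
    (a b : nat -> nat -> R[i]) :
  admissible nu ->
  (k <= m)%N ->
  smop U P ->
  smop V Q ->
  coherent nu M N m k P Q a b ->
  \det (Lmx M N a b) != 0 ->
  [/\ forall n : nat, exists phi psi : {poly R[i]},
        [/\ size phi = (M + k + n).+1, size psi = (N + m + n).+1
          & iter (m - k) (DF (nustar nu)) (mulF phi V) =1 mulF psi U],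
      exists varphi rho : {poly R[i]},
        [/\ varphi != 0, rho != 0 & mulF varphi U =1 mulF rho V],
      (k = m -> (semiclassical nu U <-> semiclassical nu V))
    & ((k < m)%N -> semiclassical nu U /\ semiclassical nu V)].
Proof.
move=> adm le_km smopU smopV cohPQ detL.
have regU : regular U by exists P.
have regV : regular V by exists Q.
have reach_ex n := coherent_reach adm n le_km smopU smopV cohPQ detL.
(* [coherent_reach] supplies an element of each degree from [M + k] on, hence finite codimension. *)
have [phi phi0 reach_phi] : exists2 phi : {poly R[i]}, phi != 0
    & forall j, (j <= m - k)%N -> reach nu U V j phi.
  have [|n|phi phi0 reachX] :=
    @finite_codim_XM _ (reach nu U V (m - k)) (M + k) _ _ (m - k).
  - exact: reach_linear.
  - by have [phi [psi [size_phi _ eq_phi]]] := reach_ex n; exists phi => //; exists psi.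
  - by exists phi => //; apply: reach_le.
have [rho eq_rho] := reach_phi 0%N (leq0n _).
have rho0 : rho != 0.
  apply: contra_neq phi0 => rho0; apply: (regular_mul_eq0 smopV) => p.
  by rewrite [LHS]eq_rho rho0 mul0r linear0.
split.
- move=> n; have [phi1 [psi1 [size_phi size_psi eq_psi]]] := reach_ex n.
  exists phi1, ((-1) ^+ (m - k) *: psi1).
  split=> [//||p]; first by rewrite size_scale // signr_eq0.
  by rewrite iter_DF_nustar /= /mulF_fun eq_psi -scalerAl linearZ.
- by exists rho, phi; split=> // p; rewrite /= /mulF_fun -eq_rho.
- move=> _; split.
    by apply: (semiclassical_transfer adm regV phi0 rho0) => p; apply: eq_rho.
  by apply: (semiclassical_transfer adm regU rho0 phi0) => p; rewrite [RHS]eq_rho.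
move=> lt_km; have [|tau eq_tau] := reach_phi 1%N; first by rewrite subn_gt0.
have scU : semiclassical nu U.
  rewrite -[nu]nustarK; apply: semiclassical_nustar; first exact: admissible_nustar.
  (* Orders [0] and [1] combine, since [rho U = phi V]. *)
  have eqU : DF (nustar nu) (mulF rho U) =1 mulF (- tau) U.
    move=> p; rewrite /= /DF_fun /= /mulF_fun nustarK mulNr linearN /=.
    by congr (- _); rewrite -eq_tau -eq_rho.
  split=> //; exists rho, (- tau); split=> //.
  exact: (pearson_degree (admissible_nustar adm) regU rho0 eqU).
split=> //; apply: (semiclassical_transfer adm regV phi0 rho0) scU => p.
exact: eq_rho.
Qed.
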